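(* Let $C=(S,f,\mathit{Jur},\leq_T,\mathcal{R})\in\overline{\mathbf{TJCM}}$, let $s^{*}\in S$ with $f(s^{*})=?$, let $n\in\mathit{Names}$ and $o\in\{0,1\}$. Then $(C,s^{*})\models\mathsf{Cl}_n(o)$ if and only if $(C,s^{*})\models n$ and $f^{*}(s^{*})=\{o\}$.
   Context: **Models.** Fix $\mathit{Atm}_0=\mathit{Facts}\cup\mathit{Names}\cup\mathit{Courts}$, a union of three nonempty pairwise disjoint sets, with $\mathit{Facts}$ and $\mathit{Names}$ countable and $\mathit{Courts}$ finite, and fix a finite subset $\mathit{Names}_d\subseteq\mathit{Names}$. Let $\mathit{Val}=\{0,1,?\}$ and $\bar o=1-o$ for $o\in\{0,1\}$. A jurisdiction is a triple $(\mathit{Courts},\mathcal{H},\mathcal{B})$ with $\mathcal{H},\mathcal{B}\subseteq\mathit{Courts}\times\mathit{Courts}$ and $\mathcal{H}$ transitive and irreflexive. A temporal jurisdictional classifier model (TJCM) is a tuple $C=(S,f,\mathit{Jur},\leq_T,\mathcal{R})$ where: $S\subseteq 2^{\mathit{Atm}_0}$ is nonempty and every $s\in S$ contains exactly one element of $\mathit{Courts}$; $f:S\to\mathit{Val}$; $S_d=\{s\in S: f(s)\neq ?\}$ is finite; $\mathit{Jur}=(\mathit{Courts},\mathcal{H},\mathcal{B})$ is a jurisdiction; $\leq_T$ is a total preorder on $S$; $\mathcal{R}\subseteq S\times S$; every $s\in S$ contains some $n\in\mathit{Names}$; for all $s\in S$ and $n\in\mathit{Names}\cap s$: $s\in S_d\Leftrightarrow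 n\in\mathit{Names}_d$; for all $s\neq s'$ in $S$: $s\cap s'\cap\mathit{Names}=\emptyset$. Write $s<_T s'$ iff $s\leq_T s'$ and not $s'\leq_T s$; $\mathcal{R}(s)=\{s': s'\mathcal{R}s\}$. $\overline{\mathbf{TJCM}}$ is the class of TJCMs satisfying $\mathcal{H}\subseteq\mathcal{B}\subseteq\mathcal{H}\cup\{(c,c):c\in\mathit{Courts}\}$ and: for all $s,s'\in S$, if $f(s)\neq ?$ and $f(s')=?$ then $s<_T s'$. The court of $s,s',s''$ is denoted $c,c',c''$. $s\prec s'$ iff $c'\,\mathcal{H}\,c$; $s\cong s'$ iff $c=c'$. **Language and semantics.** $\varphi::=p\mid\mathsf{t}(o)\mid\mathsf{H}(c,c')\mid\mathsf{B}(c,c')\mid\neg\varphi\mid\varphi\wedge\varphi\mid\Box\varphi\mid[\leq_T]\varphi\mid\mathsf{R}^\forall\varphi$ with $p\in\mathit{Atm}_0$, $o\in\mathit{Val}$, $c,c'\in\mathit{Courts}$. $(C,s)\models p$ iff $p\in s$; $\models\mathsf{t}(o)$ iff $f(s)=o$; $\models\mathsf{H}(c,c')$ iff $c\,\mathcal{H}\,c'$; $\models\mathsf{B}(c,c')$ iff $c\,\mathcal{B}\,c'$; Boolean clauses as usual; $\models\Box\varphi$ iff $\varphi$ holds at all $s'\in S$; $\models[\leq_T]\varphi$ iff $\varphi$ holds at all $s'$ with $s\leq_T s'$; $\models\mathsf{R}^\forall\varphi$ iff $\varphi$ holds at all $s'\in\mathcal{R}(s)$. Duals: $\Diamond=\neg\Box\neg$,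 $\langle\leq_T\rangle=\neg[\leq_T]\neg$, $\mathsf{R}^\exists=\neg\mathsf{R}^\forall\neg$. Empty disjunctions are false, empty conjunctions true. **Semantic notions** ($o\in\{0,1\}$). $\Pi(s',s,o)$ iff $f(s')=o$, $s'\in\mathcal{R}(s)$, $s'<_T s$. $\beta(s',s,o)$ iff $\Pi(s',s,o)$ and $c'\,\mathcal{B}\,c$; $\beta_s=\{s':\exists o\in\{0,1\},\ \beta(s',s,o)\}$. $O(c',c)$ (for courts) iff $c'\,\mathcal{H}\,c$ or ($c'=c$ and not $c\,\mathcal{B}\,c$). $O(s',s)$ (for states) iff for some $o\in\{0,1\}$: $\Pi(s,s',o)$, $f(s')=\bar o$ and $O(c',c)$; $\omega_s=\{s':O(s',s)\}$; $\mathit{Overrule}_T(s,\tilde s)=\{s':O(s',s),\ s'<_T\tilde s\}$. $\mathit{Against}(s,s')$ iff $f(s)=o\in\{0,1\}$ and $\beta(s',s,\bar o)$; $\mathit{According}(s,s')$ iff $f(s)=o\in\{0,1\}$ and $\beta(s',s,o)$. For $f(s)\neq ?$, the $s$-graph is $G_s=(V_s,E_s)=\bigcup_{k\geq 0}(V_k,E_k)$ with $V_0=\{s\}$, $E_0=\emptyset$, $V_{k+1}=V_k\cup\{s': s'\in\beta_{s''}\cup\omega_{s''},\ s''\in V_k\}$, $E_{k+1}=E_k\cup\{(s'',s'): s'\in\beta_{s''}\cup\omega_{s''},\ s''\in V_k\}$; it is a finite directed acyclic graph. Recursively along these graphs, $\mathit{Incuriam}(s)$ holds iff there is $s'\in S$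 such that: (1) $(s,s')\in E_s$, $\mathit{Against}(s,s')$, ($\mathit{Incuriam}(s')\Rightarrow s\prec s'$), and $\mathit{Incuriam}(\tilde s)$ for all $\tilde s\in\mathit{Overrule}_T(s',s)$; and (2) for every $s''\in S$ with $(s,s'')\in E_s$ and $\mathit{According}(s,s'')$: [$\mathit{Incuriam}(s'')$ and $s\not\prec s''$], or [some $\tilde s\in\mathit{Overrule}_T(s'',s)$ is not $\mathit{Incuriam}$], or [($s''<_T s'$ and $s'\cong s''$) or $s''\prec s'$]. ($\mathit{Incuriam}(s)$ is false if $f(s)=?$.) $\mathit{Overruled}(s)$ iff some $s'\in\omega_s$ is not $\mathit{Incuriam}$. $\overline\beta_s$ is the set of $s'\in\beta_s$ such that not ($\mathit{Incuriam}(s')$ and $s\cong s'$) and not $\mathit{Overruled}(s')$. $\mathit{Best}_{TH}(\overline\beta_s)=\{s'\in\overline\beta_s:\forall s''\in\overline\beta_s,\ s'\not\prec s''\text{ and not }(s'\cong s''\text{ and }s'<_T s'')\}$. For the state $s^*$ with $f(s^* )=?$, $f^{*}:S\to 2^{\{0,1,?\}}$ is given by $f^*(s)=\{f(s)\}$ if $s\neq s^*$ and $f^*(s^* )=\{f(s'):s'\in\mathit{Best}_{TH}(\overline\beta_{s^*})\}$. **Formulas** ($n,m\in\mathit{Names}$). - $\hat{\mathsf F}_n\varphi:=n\wedge\langle\leq_T\rangle(\neg\langle\leq_T\rangle n\wedge\varphi)$; $\hat{\mathsf P}_{n,m}\varphi:=n\wedge\Diamond(\varphi\wedge\hat{\mathsf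 F}_m n)$; $\hat{\mathsf F}\varphi:=\bigvee_{n\in\mathit{Names}_d}(n\wedge\hat{\mathsf F}_n\varphi)$; $\hat{\mathsf P}\varphi:=\bigvee_{n,m\in\mathit{Names}_d}(n\wedge\hat{\mathsf P}_{n,m}\varphi)$. - $\mathsf{Lower}\,\varphi:=\bigvee_{c,c'}(c\wedge\mathsf{H}(c,c')\wedge\Diamond(c'\wedge\varphi))$; $\mathsf{Higher}\,\varphi:=\bigvee_{c,c'}(c\wedge\mathsf{H}(c',c)\wedge\Diamond(c'\wedge\varphi))$; $\mathsf{SameCourt}\,\varphi:=\bigvee_{c}(c\wedge\Diamond(c\wedge\varphi))$ (over $\mathit{Courts}$). - $\mathsf{Supporting}_{n,m}\varphi:=\hat{\mathsf P}_{n,m}\varphi\wedge\mathsf{R}^\exists(\varphi\wedge m)$; $\mathsf{PBinding}_{n,m}\varphi:=\bigvee_{c_i,c_j\in\mathit{Courts}}(c_j\wedge\mathsf{B}(c_i,c_j)\wedge\mathsf{Supporting}_{n,m}(c_i\wedge\varphi))$. - $\mathsf{PwOver}(c_i):=\bigvee_{c_j\neq c_i}(c_j\wedge\mathsf{H}(c_j,c_i))\vee(c_i\wedge\neg\mathsf{B}(c_i,c_i))$; $\mathsf{POverruling}_{n,m}\varphi:=\bigvee_{o\in\{0,1\},c\in\mathit{Courts}}\big(n\wedge c\wedge\Diamond(\varphi\wedge\mathsf{t}(\bar o)\wedge\mathsf{PwOver}(c)\wedge\mathsf{Supporting}_{m,n}\mathsf{t}(o))\big)$. - $\mathsf{Against}_{n,m}\varphi:=\bigvee_{o\in\{0,1\}}(\mathsf{t}(o)\wedge\mathsf{PBinding}_{n,m}(\varphi\wedge\mathsf{t}(\bar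 o)))$; $\mathsf{According}_{n,m}\varphi:=\bigvee_{o\in\{0,1\}}(\mathsf{t}(o)\wedge\mathsf{PBinding}_{n,m}(\varphi\wedge\mathsf{t}(o)))$. - $\mathsf{Against}\,\varphi:=\bigvee_{n,m\in\mathit{Names}_d}(n\wedge\mathsf{Against}_{n,m}\varphi)$; $\mathsf{POverruling}\,\varphi:=\bigvee_{n,m\in\mathit{Names}_d}(n\wedge\mathsf{POverruling}_{n,m}\varphi)$; $\mathsf{According}^\forall\varphi:=\bigvee_{n\in\mathit{Names}_d}(n\wedge\bigwedge_{m\in\mathit{Names}_d}\neg\mathsf{According}_{n,m}\neg\varphi)$; $\mathsf{POverruling}^\forall\varphi:=\bigvee_{n\in\mathit{Names}_d}(n\wedge\bigwedge_{m\in\mathit{Names}_d}\neg\mathsf{POverruling}_{n,m}\neg\varphi)$. - $\iota^{1}:=\bigvee_{m\in\mathit{Names}_d}\big(\mathsf{Against}(m)\wedge\mathsf{According}^\forall((\hat{\mathsf F}m\wedge\mathsf{SameCourt}(m))\vee\mathsf{Higher}(m))\big)$, and for $k\geq1$: $\iota^{k+1}:=\bigvee_{n,m\in\mathit{Names}_d}\Big(n\wedge\mathsf{Against}\big(m\wedge(\neg\iota^{k}\vee\mathsf{Lower}(n))\wedge\mathsf{POverruling}^\forall(\hat{\mathsf F}n\to\iota^{k})\big)\wedge\mathsf{According}^\forall\big((\iota^{k}\wedge\neg\mathsf{Lower}(n))\vee\mathsf{POverruling}(\hat{\mathsf F}n\wedge\neg\iota^{k})\vee(\hat{\mathsf F}m\wedge\mathsf{SameCourt}(m))\vee\mathsf{Higher}(m)\big)\Big)$.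 - $\mathsf{Incuriam}:=\bigvee_{1\leq k\leq|\mathit{Names}_d|}\bigwedge_{k\leq j\leq|\mathit{Names}_d|}\iota^{j}$; $\mathsf{Overruled}:=\mathsf{POverruling}(\neg\mathsf{Incuriam})$. - $\mathsf{Binding}_n\varphi:=\bigvee_{m\in\mathit{Names}_d}\mathsf{PBinding}_{n,m}\big(\varphi\wedge\neg\mathsf{Overruled}\wedge\neg(\mathsf{Incuriam}\wedge\mathsf{SameCourt}(n))\big)$. - $\mathsf{BestBinding}_n\varphi:=\bigvee_{m\in\mathit{Names}_d}\big(\mathsf{Binding}_n(m\wedge\varphi)\wedge\neg\mathsf{Binding}_n(\mathsf{Lower}(m)\vee(\mathsf{SameCourt}(m)\wedge\hat{\mathsf P}m))\big)$. - $\mathsf{Cl}_n(o):=\mathsf{BestBinding}_n(\mathsf{t}(o))\wedge\neg\mathsf{BestBinding}_n(\mathsf{t}(\bar o))$. *)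

(* Defs.v *)
From Stdlib Require Import Relation_Operators Wellfounded.
From mathcomp Require Import all_boot finmap.
From mathcomp Require Import boolp classical_sets functions cardinality.

Set Implicit Arguments.
Unset Strict Implicit.
Unset Printing Implicit Defensive.

Local Open Scope classical_set_scope.

(* {0,1} is bool (0 = false, 1 = true, complement = negation), and the third
   value "?" is None. *)
Definition Val := option bool.

(* Atm_0 is the disjoint union of Facts, Names and Courts. *)
Inductive atom (Facts Names : countType) (Courts : finType) : Type :=
  | Fact of Facts
  | Name of Names
  | Court of Courts.

Arguments Fact {Facts Names Courts}.
Arguments Name {Facts Names Courts}.
Arguments Court {Facts Names Courts}.

Record jurisdiction (Courts : finType) := Jurisdiction {
  jH : rel Courts;
  jB : rel Courts;
  jH_trans : transitive jH;
  jH_irr : irreflexive jH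
}.

(* [accR s' s] is s' R s: s' is one of the cases relevant for s. *)
Record tjcm (Facts Names : countType) (Courts : finType)
    (Names_d : {fset Names}) := Tjcm {
  states : set (set (atom Facts Names Courts));
  cls : states -> Val;
  jur : jurisdiction Courts;
  leT : rel states;
  accR : rel states;
  states_neq0 : states !=set0;
  states_court : forall s : states, exists! c, val s (Court c);
  assessed_finite : finite_set [set s : states | cls s <> None];
  leT_refl : reflexive leT;
  leT_trans : transitive leT;
  leT_total : total leT;
  states_name : forall s : states, exists n, val s (Name n);
  names_assessed : forall (s : states) n, val s (Name n) ->
    (cls s <> None <-> n \in Names_d);
  names_disjoint : forall s s' : states, s <> s' ->
    forall n, ~ (val s (Name n) /\ val s' (Name n))
}.

(* Models of the class \overline{TJCM}; the first two conditions say that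
   H <= B <= H + diagonal. *)
Record tjcm_bar (Facts Names : countType) (Courts : finType)
    (Names_d : {fset Names}) := TjcmBar {
  model :> tjcm Facts Courts Names_d;
  H_sub_B : forall c c', jH (jur model) c c' -> jB (jur model) c c';
  B_sub_Hdiag : forall c c',
    jB (jur model) c c' -> jH (jur model) c c' \/ c = c';
  assessed_before : forall s s' : states model,
    cls s <> None -> cls s' = None -> leT s s' /\ ~ leT s' s
}.

Declare Scope formula_scope.
Delimit Scope formula_scope with F.

Section Language.
Variables (Facts Names : countType) (Courts : finType) (Names_d : {fset Names}).

Inductive formula : Type :=
  | Atom of atom Facts Names Courts
  | Ft of Val
  | FH of Courts & Courts
  | FB of Courts & Courts
  | Neg of formula
  | And of formula & formula
  | Box of formula
  | BoxLe of formula
  | RAll of formula.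

Fixpoint sat (C : tjcm Facts Courts Names_d) (s : states C) (phi : formula)
    : Prop :=
  match phi with
  | Atom p => val s p
  | Ft v => cls s = v
  | FH c c' => jH (jur C) c c'
  | FB c c' => jB (jur C) c c'
  | Neg a => ~ sat s a
  | And a b => sat s a /\ sat s b
  | Box a => forall s' : states C, sat s' a
  | BoxLe a => forall s' : states C, leT s s' -> sat s' a
  | RAll a => forall s' : states C, accR s' s -> sat s' a
  end.

Definition Or a b := Neg (And (Neg a) (Neg b)).
Definition Imp a b := Neg (And a (Neg b)).
(* The grammar has no constants; these serve as the empty disjunction and the
   empty conjunction. *)
Definition Bot := And (Ft None) (Neg (Ft None)).
Definition Top := Neg Bot.
Definition Dia a := Neg (Box (Neg a)).
Definition DiaLe a := Neg (BoxLe (Neg a)).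
Definition REx a := Neg (RAll (Neg a)).

Definition nm (n : Names) : formula := Atom (Name n).
Definition ct (c : Courts) : formula := Atom (Court c).

Local Notation "a && b" := (And a b) : formula_scope.
Local Notation "a || b" := (Or a b) : formula_scope.
Local Notation "~~ a" := (Neg a) : formula_scope.
Local Notation "\or_ ( i : T ) F" := (\big[Or/Bot]_(i : T) F%F)
  (at level 41, F at level 41, i at level 50) : formula_scope.
Local Notation "\or_ ( i : T | P ) F" := (\big[Or/Bot]_(i : T | P%B) F%F)
  (at level 41, F at level 41, i at level 50) : formula_scope.
Local Notation "\or_ ( i <- r ) F" := (\big[Or/Bot]_(i <- r) F%F)
  (at level 41, F at level 41, i, r at level 50) : formula_scope.
Local Notation "\and_ ( i <- r ) F" := (\big[And/Top]_(i <- r) F%F)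
  (at level 41, F at level 41, i, r at level 50) : formula_scope.
Local Open Scope formula_scope.

Definition FhatN (n : Names) phi := nm n && DiaLe (~~ DiaLe (nm n) && phi).
Definition PhatN (n m : Names) phi := nm n && Dia (phi && FhatN m (nm n)).
Definition Fhat phi := \or_(n <- Names_d) (nm n && FhatN n phi).
Definition Phat phi :=
  \or_(n <- Names_d) \or_(m <- Names_d) (nm n && PhatN n m phi).

Definition Lower phi :=
  \or_(c : Courts) \or_(c' : Courts) (ct c && (FH c c' && Dia (ct c' && phi))).
Definition Higher phi :=
  \or_(c : Courts) \or_(c' : Courts) (ct c && (FH c' c && Dia (ct c' && phi))).
Definition SameCourt phi := \or_(c : Courts) (ct c && Dia (ct c && phi)).

Definition Supporting (n m : Names) phi := PhatN n m phi && REx (phi && nm m).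
Definition PBinding (n m : Names) phi :=
  \or_(ci : Courts) \or_(cj : Courts)
    (ct cj && (FB ci cj && Supporting n m (ct ci && phi))).

Definition PwOver (ci : Courts) :=
  (\or_(cj : Courts | cj != ci) (ct cj && FH cj ci)) || (ct ci && ~~ FB ci ci).
Definition POverrulingN (n m : Names) phi :=
  \or_(o : bool) \or_(c : Courts)
    (nm n && (ct c &&
      Dia (phi && (Ft (Some (negb o)) &&
           (PwOver c && Supporting m n (Ft (Some o))))))).

Definition AgainstN (n m : Names) phi :=
  \or_(o : bool)
    (Ft (Some o) && PBinding n m (phi && Ft (Some (negb o)))).
Definition AccordingN (n m : Names) phi :=
  \or_(o : bool)
    (Ft (Some o) && PBinding n m (phi && Ft (Some o))).

Definition Against phi :=
  \or_(n <- Names_d) \or_(m <- Names_d) (nm n && AgainstN n m phi).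
Definition POverruling phi :=
  \or_(n <- Names_d) \or_(m <- Names_d) (nm n && POverrulingN n m phi).
Definition AccordingAll phi :=
  \or_(n <- Names_d)
    (nm n && \and_(m <- Names_d) (~~ AccordingN n m (~~ phi))).
Definition POverrulingAll phi :=
  \or_(n <- Names_d)
    (nm n && \and_(m <- Names_d) (~~ POverrulingN n m (~~ phi))).

Definition inc_first : formula :=
  \or_(m <- Names_d)
    (Against (nm m) &&
     AccordingAll ((Fhat (nm m) && SameCourt (nm m)) || Higher (nm m))).

Definition inc_next (i : formula) : formula :=
  \or_(n <- Names_d) \or_(m <- Names_d)
    (nm n &&
     (Against (nm m && ((~~ i || Lower (nm n)) &&
                        POverrulingAll (Imp (Fhat (nm n)) i))) &&
      AccordingAll ((i && ~~ Lower (nm n)) ||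
                    (POverruling (Fhat (nm n) && ~~ i) ||
                     ((Fhat (nm m) && SameCourt (nm m)) || Higher (nm m)))))).

(* iota^k, meaningful for 1 <= k; the value at 0 is never used. *)
Fixpoint inc_iter (k : nat) : formula :=
  match k with
  | 0 => Bot
  | k'.+1 => if k' is 0 then inc_first else inc_next (inc_iter k')
  end.

Definition FIncuriam : formula :=
  \or_(k <- index_iota 1 (#|` Names_d|).+1)
    \and_(j <- index_iota k (#|` Names_d|).+1) inc_iter j.
Definition FOverruled : formula := POverruling (~~ FIncuriam).

Definition Binding (n : Names) phi :=
  \or_(m <- Names_d)
    PBinding n m
      (phi && (~~ FOverruled && ~~ (FIncuriam && SameCourt (nm n)))).
Definition BestBinding (n : Names) phi :=
  \or_(m <- Names_d)
    (Binding n (nm m && phi) &&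
     ~~ Binding n (Lower (nm m) || (SameCourt (nm m) && Phat (nm m)))).
Definition Cl (n : Names) (o : bool) :=
  BestBinding n (Ft (Some o)) && ~~ BestBinding n (Ft (Some (negb o))).

End Language.

Arguments Atom {Facts Names Courts}.

Section Semantics.
Variables (Facts Names : countType) (Courts : finType) (Names_d : {fset Names}).

Section Model.
Variable C : tjcm Facts Courts Names_d.
Implicit Types (s : states C) (o : bool) (c : Courts).

Definition court s : Courts := sval (cid (states_court s)).

Definition ltT s s' : Prop := leT s s' /\ ~ leT s' s.

(* s \prec s' : the court of s' is higher than that of s. *)
Definition below_court s s' : Prop := jH (jur C) (court s') (court s).
Definition same_court s s' : Prop := court s = court s'.

Definition supports s' s o : Prop :=
  [/\ cls s' = Some o, accR s' s & ltT s' s].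

Definition binds s' s o : Prop :=
  supports s' s o /\ jB (jur C) (court s') (court s).

Definition beta s : set (states C) := [set s' | exists o, binds s' s o].

Definition overpower c' c : Prop :=
  jH (jur C) c' c \/ (c' = c /\ ~ jB (jur C) c c).

Definition overrules s' s : Prop := exists o : bool,
  [/\ supports s s' o, cls s' = Some (~~ o) & overpower (court s') (court s)].

Definition omega s : set (states C) := [set s' | overrules s' s].

Definition OverruleT s t : set (states C) :=
  [set s' | overrules s' s /\ ltT s' t].

Definition SAgainst s s' : Prop :=
  exists o : bool, cls s = Some o /\ binds s' s (~~ o).
Definition SAccording s s' : Prop :=
  exists o : bool, cls s = Some o /\ binds s' s o.

Fixpoint graphV s (k : nat) : set (states C) :=
  if k is k'.+1 then
    graphV s k' `|`
    [set s' | exists s'', graphV s k' s'' /\ (beta s'' `|` omega s'') s']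
  else [set s].

Fixpoint graphE s (k : nat) : set (states C * states C) :=
  if k is k'.+1 then
    graphE s k' `|`
    [set e | graphV s k' e.1 /\ (beta e.1 `|` omega e.1) e.2]
  else set0.

Definition sgraphE s : set (states C * states C) := \bigcup_k graphE s k.

(* The body of the recursive definition of Incuriam, with [I] standing for the
   recursive calls. *)
Definition incuriam_body (I : states C -> Prop) s : Prop :=
  cls s <> None /\
  exists s',
    [/\ sgraphE s (s, s'),
        SAgainst s s',
        (I s' -> below_court s s') &
        (forall t, OverruleT s' s t -> I t)] /\
    (forall s'', sgraphE s (s, s'') -> SAccording s s'' ->
       [\/ I s'' /\ ~ below_court s s'',
           (exists t, OverruleT s'' s t /\ ~ I t) |
           (ltT s'' s' /\ same_court s' s'') \/ below_court s'' s']).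

(* [desc s' s]: there is a nonempty path from s to s' along the edges. *)
Definition edge s' s : Prop := (beta s `|` omega s) s'.
Definition desc : states C -> states C -> Prop := clos_trans (states C) edge.

Lemma sgraphE_edge s t u : sgraphE s (t, u) -> edge u t.
Proof.
case=> k _; elim: k => [//|k IH] /= -[/IH //|[]] //.
Qed.

Lemma OverruleT_edge s t s' : OverruleT s t s' -> edge s' s.
Proof. by case=> ? _; right. Qed.

Lemma ltT_irr s : ~ ltT s s.
Proof. by case. Qed.

Lemma ltT_trans s t u : ltT s t -> ltT t u -> ltT s u.
Proof.
move=> [st nts] [tu nut]; split; first exact: leT_trans st tu.
by move=> us; apply: nts; exact: leT_trans tu us.
Qed.

End Model.

Variable C : tjcm_bar Facts Courts Names_d.
Implicit Types (s : states C) (o : bool).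

Lemma desc_court s' s : desc s' s ->
  jH (jur C) (court s') (court s) \/
  (court s' = court s /\
   ((jB (jur C) (court s) (court s) /\ ltT s' s) \/
    (~ jB (jur C) (court s) (court s) /\ ltT s s'))).
Proof.
elim=> {s' s} [s' s|s t u _ IH1 _ IH2].
- case=> [[o [[_ _ lt] B]]|[o [[_ _ lt] _ [H|[e nB]]]]].
  + case: (B_sub_Hdiag B) => [H|e]; [by left|right; split=> //; left].
    by split=> //; rewrite -{1}e.
  + by left.
  + by right; split=> //; right.
- case: IH1 => [H1|[e1 D1]]; case: IH2 => [H2|[e2 D2]].
  + by left; exact: jH_trans H1 H2.
  + by left; rewrite -e2.
  + by left; rewrite e1.
  + right; split; first by rewrite e1.
    rewrite e2 in D1.
    case: D1 D2 => [[b1 l1]|[b1 l1]] [[b2 l2]|[b2 l2]] //.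
    * by left; split=> //; exact: ltT_trans l1 l2.
    * by right; split=> //; exact: ltT_trans l2 l1.
Qed.

Lemma desc_irr s : ~ desc s s.
Proof.
by move/desc_court => [|[_ [[_]|[_]]]]; [rewrite jH_irr|exact: ltT_irr..].
Qed.

Lemma desc_assessed s' s : desc s' s -> cls s' <> None.
Proof.
by elim=> {s' s} [s' s|//]; case=> [[o [[-> _ _] _]]|[o [_ -> _]]].
Qed.

Lemma edge_wf : well_founded (@edge C).
Proof.
have [l lP] : exists l : seq (states C), forall s, cls s <> None -> s \in l.
  have /finite_seqP[l lE] := assessed_finite C.
  by exists l => s hs; have : [set` l] s by rewrite -lE.
pose mu s := count (fun x => `[< desc x s >]) l.
have mu_lt s' s : edge s' s -> mu s' < mu s.
  move=> e; have d : desc s' s by exact: t_step.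
  have sub : subpred (fun x => `[< desc x s' >]) (fun x => `[< desc x s >]).
    by move=> x /asboolP dx; apply/asboolP; exact: t_trans dx d.
  have := lP _ (desc_assessed d); rewrite /mu.
  elim: l {lP mu} => [//|x l IH]; rewrite inE /= => /predU1P[<-|/IH lt].
    rewrite (asboolF (@desc_irr s')) (asboolT d) add0n add1n ltnS.
    exact: sub_count.
  rewrite -addnS leq_add //.
  by case: (boolP `[< desc x s' >]) => // /sub ->.
move=> s; have [n] := ubnP (mu s); elim: n s => [//|n IH] s.
rewrite ltnS => le; constructor => s' /mu_lt lt.
by apply: IH; exact: leq_trans lt le.
Qed.

Lemma desc_wf : well_founded (@desc C).
Proof. exact: wf_clos_trans edge_wf. Qed.

(* Recursion along the edges; a recursive call is only allowed on proper
   descendants, which covers all calls in the body (see incuriamE). *)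
Definition Incuriam : states C -> Prop :=
  Fix desc_wf (fun _ => Prop)
    (fun s rec => incuriam_body (fun t => exists d : desc t s, rec t d) s).

Lemma incuriam_body_ext (I J : states C -> Prop) s :
  (forall t, desc t s -> I t <-> J t) -> incuriam_body I s -> incuriam_body J s.
Proof.
move=> IJ [hs [s' [[e ag i1 i2] h]]]; split=> //; exists s'.
have st u t : sgraphE s (s, u) -> OverruleT u s t -> desc t s.
  move=> /sgraphE_edge eu /OverruleT_edge et.
  by apply: (t_trans _ _ _ u); exact: t_step.
split.
  split=> //.
    by move=> Js'; apply: i1; apply/IJ => //; apply/t_step/sgraphE_edge/e.
  by move=> t ht; apply/IJ; [exact: st ht|exact: i2].
move=> s'' es as'; case: (h _ es as') => [[a b]|[t [ht nt]]|k].
- apply: Or31; split=> //; apply/IJ => //; exact/t_step/sgraphE_edge/es.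
- apply: Or32; exists t; split=> // Jt; apply: nt; apply/IJ => //.
  exact: st ht.
- exact: Or33.
Qed.

Lemma incuriamE s : Incuriam s <-> incuriam_body Incuriam s.
Proof.
rewrite {1}/Incuriam Fix_eq; last first.
  move=> x f g fg; congr (incuriam_body _ x); apply/funext => t.
  by apply/propext; split=> -[d]; exists d; rewrite ?fg // -fg.
split; apply: incuriam_body_ext => t d; first by split=> [[]|i] //; exists d.
by split=> [i|[]] //; exists d.
Qed.

Definition SOverruled s : Prop := exists s', omega s s' /\ ~ Incuriam s'.

Definition beta_bar s : set (states C) :=
  [set s' | [/\ beta s s', ~ (Incuriam s' /\ same_court s s') &
                ~ SOverruled s']].

Definition BestTH (X : set (states C)) : set (states C) :=
  [set s' | X s' /\ forall s'', X s'' ->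
     ~ below_court s' s'' /\ ~ (same_court s' s'' /\ ltT s' s'')].

(* f^*, for the given undecided state [sstar]. *)
Definition fstar (sstar s : states C) : set Val :=
  if `[< s = sstar >] then [set cls s' | s' in BestTH (beta_bar sstar)]
  else [set cls s].

End Semantics.

(* Main.v *)
Require Import Defs.
From Stdlib Require Import Relation_Operators.
From mathcomp Require Import all_boot finmap.
From mathcomp Require Import boolp classical_sets functions cardinality.

(* Since names identify states, each modal formula defines the semantic notion
   it is named after; in particular iota^(k+1) is one unfolding of the recursive
   equation of Incuriam with iota^k for the recursive calls. A state whose
   proper descendants carry fewer than k names of Names_d is thus classified
   correctly by iota^k (a leaf satisfies neither Incuriam nor iota^1, for want
   of a contrary precedent). An assessed state is not its own descendant, so
   its descendants miss at least one name and iota^|Names_d| is exact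
   everywhere; this last disjunct decides the formula Incuriam. *)

Set Implicit Arguments.
Unset Strict Implicit.
Unset Printing Implicit Defensive.

Local Open Scope classical_set_scope.

(** * Connectives, modalities and finite disjunctions *)

Section Sat.
Variables (Facts Names : countType) (Courts : finType) (Names_d : {fset Names}).
Variable C : tjcm Facts Courts Names_d.
Local Notation fm := (formula Facts Names Courts).
Implicit Types (s t : states C) (phi psi : fm) (n m : Names) (c : Courts).

Lemma sat_And s phi psi : sat s (And phi psi) <-> sat s phi /\ sat s psi.
Proof. by []. Qed.

Lemma sat_Neg s phi : sat s (Neg phi) <-> ~ sat s phi.
Proof. by []. Qed.

Lemma sat_Or s phi psi : sat s (Or phi psi) <-> sat s phi \/ sat s psi.
Proof. by rewrite /= -not_orE; split=> [/contrapT|h /(_ h)]. Qed.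

Lemma sat_Imp s phi psi : sat s (Imp phi psi) <-> (sat s phi -> sat s psi).
Proof.
split=> [/= h p|h [p]]; last by apply; exact: h.
by apply: contrapT => np; apply: h.
Qed.

Lemma sat_Bot s : ~ sat s (Bot _ _ _).
Proof. by case. Qed.

Lemma sat_Dia s phi : sat s (Dia phi) <-> exists t, sat t phi.
Proof.
by split=> [/existsNP[t /contrapT]|[t st] /(_ t)] //; exists t.
Qed.

Lemma sat_DiaLe s phi : sat s (DiaLe phi) <-> exists t, leT s t /\ sat t phi.
Proof.
split=> [/existsNP[t /not_implyP[le /contrapT]]|[t [le st]] /(_ t le)] //.
by exists t.
Qed.

Lemma sat_REx s phi : sat s (REx phi) <-> exists t, accR t s /\ sat t phi.
Proof.
split=> [/existsNP[t /not_implyP[le /contrapT]]|[t [le st]] /(_ t le)] //.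
by exists t.
Qed.

Lemma sat_bigOr (I : eqType) (r : seq I) (P : pred I) (F : I -> fm) s :
  sat s (\big[@Or _ _ _/Bot _ _ _]_(i <- r | P i) F i) <->
  exists i, [/\ i \in r, P i & sat s (F i)].
Proof.
elim: r => [|x r IH].
  by rewrite big_nil; split=> [/sat_Bot|[i []]] //; rewrite in_nil.
rewrite big_cons; case: ifP => Px; [rewrite sat_Or|]; rewrite IH; split.
- case=> [h|[i [ir Pi h]]]; first by exists x; rewrite mem_head.
  by exists i; rewrite inE ir orbT.
- by case=> i []; rewrite inE => /predU1P[->|ir] Pi h; [left|right; exists i].
- by case=> i [ir Pi h]; exists i; rewrite inE ir orbT.
(* Here [P x] fails, so a witness equal to [x] is contradictory. *)
- case=> i []; rewrite inE => /predU1P[->|ir] Pi h; last by exists i.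
  by rewrite Px in Pi.
Qed.

Lemma sat_bigOr_seq (I : eqType) (r : seq I) (F : I -> fm) s :
  sat s (\big[@Or _ _ _/Bot _ _ _]_(i <- r) F i) <->
  exists2 i, i \in r & sat s (F i).
Proof.
by rewrite sat_bigOr; split=> [[i [ir _ h]]|[i ir h]]; exists i.
Qed.

Lemma sat_bigOr_fin (I : finType) (P : pred I) (F : I -> fm) s :
  sat s (\big[@Or _ _ _/Bot _ _ _]_(i : I | P i) F i) <->
  exists2 i, P i & sat s (F i).
Proof.
by rewrite sat_bigOr; split=> [[i [_ Pi h]]|[i Pi h]]; exists i.
Qed.

Lemma sat_bigAnd_seq (I : eqType) (r : seq I) (F : I -> fm) s :
  sat s (\big[@And _ _ _/Top _ _ _]_(i <- r) F i) <->
  forall i, i \in r -> sat s (F i).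
Proof.
elim: r => [|x r IH]; first by rewrite big_nil; split=> [//|_ []].
rewrite big_cons /= IH; split=> [[hx h] i|h].
  by rewrite inE => /predU1P[->|/h].
by split=> [|i ir]; apply: h; rewrite ?mem_head // inE ir orbT.
Qed.

(** * Courts, names and the temporal modalities *)

Lemma sat_ct s c : sat s (ct _ _ c) <-> court s = c.
Proof.
rewrite /court; case: cid => c0 [h u] /=; split=> [|<-//]; exact: u.
Qed.

Lemma name_inj s t n : val s (Name n) -> val t (Name n) -> s = t.
Proof.
move=> sn tn; apply: contrapT => st; exact: names_disjoint st n (conj sn tn).
Qed.

Lemma assessed_name s :
  cls s <> None -> exists2 n, n \in Names_d & val s (Name n).
Proof.
by have [n sn] := states_name s; exists n => //; exact/(names_assessed sn).
Qed.

Lemma name_assessed s n : val s (Name n) -> n \in Names_d -> cls s <> None.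
Proof. by case/names_assessed. Qed.

Lemma assessed_Names_d s n :
  cls s <> None -> val s (Name n) -> n \in Names_d.
Proof. by move=> h /names_assessed[/(_ h)]. Qed.

(** Names act as nominals: a modality applied to the bare name of [t] is tested at [t] alone. This
    turns formulas such as [Lower (nm n)] into relations to a fixed state. *)
Lemma exists_named (P : states C -> Prop) t n : val t (Name n) ->
  (exists s, P s /\ val s (Name n)) <-> P t.
Proof.
by move=> tn; split=> [[s [Ps /name_inj/(_ tn) <-]]|] //; exists t.
Qed.

(** Only [s] carries [n], so the conjunct saying that [n] is not reachable from [t] means that [t]
    does not precede [s]. This makes the order strict. *)
Lemma sat_FhatN s n phi : sat s (FhatN n phi) <->
  val s (Name n) /\ exists t, ltT s t /\ sat t phi.
Proof.
split=> [/sat_And[sn /sat_DiaLe[t [le /sat_And[/sat_Neg nt st]]]]|].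
  split=> //; exists t; split=> //; split=> // ts; apply: nt.
  by apply/sat_DiaLe; exists s.
case=> sn [t [[le nle] st]]; apply/sat_And; split=> //.
apply/sat_DiaLe; exists t; split=> //.
apply/sat_And; split=> //; apply/sat_Neg.
by move=> /sat_DiaLe[u [tu /name_inj/(_ sn) e]]; apply: nle; rewrite -e.
Qed.

(** The past is reached through the global modality: it jumps to a state named [m] that sees [n] in
    its strict future, and the state seen there can only be [s]. *)
Lemma sat_PhatN s n m phi : sat s (PhatN n m phi) <->
  val s (Name n) /\ exists t, [/\ val t (Name m), ltT t s & sat t phi].
Proof.
split=> [/sat_And[sn /sat_Dia[t /sat_And[st /sat_FhatN[tm [u []]]]]]|].
  by move=> lt /name_inj/(_ sn) e; split=> //; exists t; rewrite -e.
case=> sn [t [tm lt st]]; apply/sat_And; split=> //.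
apply/sat_Dia; exists t; apply/sat_And; split=> //.
by apply/sat_FhatN; split=> //; exists s.
Qed.

Lemma sat_Fhat s phi : sat s (Fhat Names_d phi) <->
  cls s <> None /\ exists t, ltT s t /\ sat t phi.
Proof.
rewrite sat_bigOr_seq; split=> [[n nd /sat_And[sn /sat_FhatN[_ h]]]|[ds h]].
  by split=> //; exact: name_assessed sn nd.
have [n nd sn] := assessed_name ds; exists n => //.
by apply/sat_And; split=> //; exact/sat_FhatN.
Qed.

Lemma sat_Phat s phi : sat s (Phat Names_d phi) <->
  cls s <> None /\ exists t, [/\ cls t <> None, ltT t s & sat t phi].
Proof.
rewrite sat_bigOr_seq; split.
  case=> n nd /sat_bigOr_seq[m md /sat_And[sn /sat_PhatN[_ [t [tm lt st]]]]].
  split; first exact: name_assessed sn nd.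
  by exists t; split=> //; exact: name_assessed tm md.
move=> [ds [t [dt lt st]]]; have [n nd sn] := assessed_name ds.
have [m md tm] := assessed_name dt; exists n => //; apply/sat_bigOr_seq.
exists m => //; apply/sat_And; split=> //; apply/sat_PhatN; split=> //.
by exists t.
Qed.

(** * Comparison of courts *)

Lemma sat_Lower s phi :
  sat s (Lower phi) <-> exists t, below_court t s /\ sat t phi.
Proof.
rewrite sat_bigOr_fin; split.
  case=> c _ /sat_bigOr_fin[c' _ /sat_And[/sat_ct <-]].
  case/sat_And=> H /sat_Dia[t /sat_And[/sat_ct e st]].
  by exists t; rewrite /below_court e.
case=> t [b st]; exists (court s) => //; apply/sat_bigOr_fin.
exists (court t) => //; apply/sat_And; split; first exact/sat_ct.
apply/sat_And; split=> //.
by apply/sat_Dia; exists t; apply/sat_And; split=> //; exact/sat_ct.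
Qed.

Lemma sat_Higher s phi :
  sat s (Higher phi) <-> exists t, below_court s t /\ sat t phi.
Proof.
rewrite sat_bigOr_fin; split.
  case=> c _ /sat_bigOr_fin[c' _ /sat_And[/sat_ct <-]].
  case/sat_And=> H /sat_Dia[t /sat_And[/sat_ct e st]].
  by exists t; rewrite /below_court e.
case=> t [b st]; exists (court s) => //; apply/sat_bigOr_fin.
exists (court t) => //; apply/sat_And; split; first exact/sat_ct.
apply/sat_And; split=> //.
by apply/sat_Dia; exists t; apply/sat_And; split=> //; exact/sat_ct.
Qed.

Lemma sat_SameCourt s phi :
  sat s (SameCourt phi) <-> exists t, same_court s t /\ sat t phi.
Proof.
rewrite sat_bigOr_fin; split.
  case=> c _ /sat_And[/sat_ct <- /sat_Dia[t /sat_And[/sat_ct e st]]].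
  by exists t.
case=> t [b st]; exists (court s) => //; apply/sat_And.
split; first exact/sat_ct.
by apply/sat_Dia; exists t; apply/sat_And; split=> //; exact/sat_ct.
Qed.

(** * Supporting, binding and overruling precedents *)

Lemma sat_Supporting s n m phi : sat s (Supporting n m phi) <->
  val s (Name n) /\
  exists t, [/\ val t (Name m), ltT t s, accR t s & sat t phi].
Proof.
split=> [/sat_And[/sat_PhatN[sn [t [tm lt st]]] /sat_REx[u [R [_ um]]]]|].
  (* The temporal and the relevance conjunct have separate witnesses; their common name [m]
     identifies them. *)
  by split=> //; exists t; rewrite {3}(name_inj tm um).
case=> sn [t [tm lt R st]]; apply/sat_And; split.
  by apply/sat_PhatN; split=> //; exists t.
by apply/sat_REx; exists t.
Qed.

Lemma sat_PBinding s n m phi : sat s (PBinding n m phi) <->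
  val s (Name n) /\
  exists t, [/\ val t (Name m), ltT t s, accR t s,
    jB (jur C) (court t) (court s) & sat t phi].
Proof.
rewrite sat_bigOr_fin; split.
  case=> ci _ /sat_bigOr_fin[cj _ /sat_And[/sat_ct <-]].
  case/sat_And=> B /sat_Supporting[sn [t [tm lt R /sat_And[/sat_ct e st]]]].
  by split=> //; exists t; rewrite e.
case=> sn [t [tm lt R B st]]; exists (court t) => //; apply/sat_bigOr_fin.
exists (court s) => //; apply/sat_And; split; first exact/sat_ct.
apply/sat_And; split=> //; apply/sat_Supporting; split=> //; exists t.
by split=> //; apply/sat_And; split=> //; exact/sat_ct.
Qed.

Lemma sat_PwOver s c : sat s (PwOver _ _ c) <-> overpower C (court s) c.
Proof.
rewrite sat_Or; split=> [[]|].
- by case/sat_bigOr_fin=> cj _ /sat_And[/sat_ct -> ?]; left.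
- by case/sat_And=> /sat_ct -> ?; right.
case=> [H|[e nB]]; [left|by right; apply/sat_And; split=> //; exact/sat_ct].
apply/sat_bigOr_fin; exists (court s); last first.
  by apply/sat_And; split=> //; exact/sat_ct.
(* The side condition that the two courts differ costs nothing, because the hierarchy is
   irreflexive. *)
by apply: contraTneq H => ->; rewrite jH_irr.
Qed.

Lemma sat_POverrulingN s n m phi : sat s (POverrulingN n m phi) <->
  val s (Name n) /\
  exists t, [/\ val t (Name m), overrules t s & sat t phi].
Proof.
rewrite sat_bigOr_fin; split.
  case=> o _ /sat_bigOr_fin[c _ /sat_And[sn /sat_And[/sat_ct <-]]].
  case/sat_Dia=> t /sat_And[st /sat_And[ft]].
  case/sat_And=> /sat_PwOver pw /sat_Supporting[tm].
  (* The support is asserted at the overruling state [t]; the supporting precedent [u] is named [n],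
     hence is [s]. *)
  case=> u [/name_inj/(_ sn) -> lt R fs].
  by split=> //; exists t; split=> //; exists o.
case=> sn [t [tm [o [[fs R lt] ft pw]] st]]; exists o => //.
apply/sat_bigOr_fin; exists (court s) => //; apply/sat_And; split=> //.
apply/sat_And; split; first exact/sat_ct.
apply/sat_Dia; exists t; do 2![apply/sat_And; split=> //].
apply/sat_And; split; first exact/sat_PwOver.
by apply/sat_Supporting; split=> //; exists s.
Qed.

Lemma overrules_assessed s t : overrules t s -> cls t <> None /\ cls s <> None.
Proof. by case=> o [[-> _ _] -> _]. Qed.

Lemma binds_assessed s t o : binds t s o -> cls t <> None.
Proof. by case=> [[-> _ _] _]. Qed.

(** Both ends of an overruling are assessed, so each has a name in [Names_d] and the finite
    disjunctions miss no pair. *)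
Lemma sat_POverruling s phi : sat s (POverruling Names_d phi) <->
  exists t, overrules t s /\ sat t phi.
Proof.
rewrite sat_bigOr_seq; split.
  case=> n nd /sat_bigOr_seq[m md /sat_And[_ /sat_POverrulingN[_]]].
  by case=> t [_ ov st]; exists t.
case=> t [ov st]; have [dt ds] := overrules_assessed ov.
have [n nd sn] := assessed_name ds; have [m md tm] := assessed_name dt.
exists n => //; apply/sat_bigOr_seq; exists m => //; apply/sat_And; split=> //.
by apply/sat_POverrulingN; split=> //; exists t.
Qed.

(** Overruling states are assessed, so the conjunction over [Names_d] reaches all of them. The
    requirement on [s] comes from the outer disjunction, which asks for a name of [s] in
    [Names_d]. *)
Lemma sat_POverrulingAll s phi : sat s (POverrulingAll Names_d phi) <->
  cls s <> None /\ forall t, overrules t s -> sat t phi.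
Proof.
rewrite sat_bigOr_seq; split.
  case=> n nd /sat_And[sn /sat_bigAnd_seq h].
  split; first exact: name_assessed sn nd.
  move=> t ov; apply: contrapT => nst.
  have [m md tm] := assessed_name (overrules_assessed ov).1.
  by apply: (h m md); apply/sat_POverrulingN; split=> //; exists t.
case=> ds h; have [n nd sn] := assessed_name ds; exists n => //.
apply/sat_And; split=> //; apply/sat_bigAnd_seq => m md.
apply/sat_Neg => /sat_POverrulingN[_ [t [_ ov]]]; apply; exact: h.
Qed.

Lemma sat_PBinding_cls s n m phi o :
  sat s (PBinding n m (And phi (Ft _ _ _ (Some o)))) <->
  val s (Name n) /\ exists t, [/\ val t (Name m), binds t s o & sat t phi].
Proof.
rewrite sat_PBinding; split.
  by case=> sn [t [tm lt R B /sat_And[st ft]]]; split=> //; exists t.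
by case=> sn [t [tm [[ft R lt] B] st]]; split=> //; exists t.
Qed.

Lemma sat_Against s phi : sat s (Against Names_d phi) <->
  exists t, SAgainst s t /\ sat t phi.
Proof.
rewrite sat_bigOr_seq; split.
  case=> n nd /sat_bigOr_seq[m md /sat_And[sn /sat_bigOr_fin[o _]]].
  case/sat_And=> fs /sat_PBinding_cls[_ [t [tm b st]]].
  by exists t; split=> //; exists o.
case=> t [[o [fs b]] st].
have [n nd sn] : exists2 n, n \in Names_d & val s (Name n).
  by apply: assessed_name; rewrite fs.
have [m md tm] := assessed_name (binds_assessed b).
exists n => //; apply/sat_bigOr_seq; exists m => //; apply/sat_And; split=> //.
apply/sat_bigOr_fin; exists o => //; apply/sat_And; split=> //.
by apply/sat_PBinding_cls; split=> //; exists t.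
Qed.

Lemma sat_AccordingAll s phi : sat s (AccordingAll Names_d phi) <->
  cls s <> None /\ forall t, SAccording s t -> sat t phi.
Proof.
rewrite sat_bigOr_seq; split.
  case=> n nd /sat_And[sn /sat_bigAnd_seq h].
  split; first exact: name_assessed sn nd.
  move=> t [o [fs b]]; apply: contrapT => nst.
  have [m md tm] := assessed_name (binds_assessed b).
  have /sat_Neg := h m md; apply; apply/sat_bigOr_fin; exists o => //.
  apply/sat_And; split=> //.
  by apply/sat_PBinding_cls; split=> //; exists t.
case=> ds h; have [n nd sn] := assessed_name ds; exists n => //.
apply/sat_And; split=> //; apply/sat_bigAnd_seq => m md.
apply/sat_Neg => /sat_bigOr_fin[o _].
case/sat_And=> fs /sat_PBinding_cls[_ [t [_ b]]]; apply; apply: h.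
by exists o.
Qed.

(** * One unfolding of the recursive equation of incuriam *)

Lemma sgraphE_out s t : edge t s -> sgraphE s (s, t).
Proof. by move=> e; exists 1 => //; right. Qed.

Lemma SAgainst_edge s t : SAgainst s t -> edge t s.
Proof. by case=> o [_ b]; left; exists (~~ o). Qed.

Lemma SAccording_edge s t : SAccording s t -> edge t s.
Proof. by case=> o [_ b]; left; exists o. Qed.

Lemma SAgainst_assessed s t : SAgainst s t -> cls s <> None /\ cls t <> None.
Proof. by case=> o [-> /binds_assessed]. Qed.

Lemma SAccording_assessed s t : SAccording s t -> cls t <> None.
Proof. by case=> o [_ /binds_assessed]. Qed.

Lemma sat_inc_first s :
  sat s (inc_first _ _ Names_d) -> exists t, SAgainst s t.
Proof.
by case/sat_bigOr_seq=> m _ /sat_And[/sat_Against[t [ag _]] _]; exists t.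
Qed.

Lemma sat_same_higher s t m : cls s <> None -> val t (Name m) ->
  sat s (Or (And (Fhat Names_d (nm _ _ m)) (SameCourt (nm _ _ m)))
            (Higher (nm _ _ m))) <->
  (ltT s t /\ same_court t s) \/ below_court s t.
Proof.
move=> ds tm; rewrite sat_Or sat_And sat_Fhat sat_SameCourt sat_Higher.
rewrite !(exists_named _ tm) /same_court; split.
  by case=> [[[_ lt] <-]|]; [left|right].
by case=> [[lt <-]|]; [left|right].
Qed.

(** In the formula [n] names [s] and [m] names the contrary precedent [s']. The graph conditions of
    the body come for free, since contrary and according precedents are direct successors of [s].
    The time bound in [OverruleT] is expressed by [Fhat (nm n)] at the overruling state. *)
Lemma sat_inc_next s phi :
  sat s (inc_next Names_d phi) <-> incuriam_body (fun t => sat t phi) s.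
Proof.
rewrite sat_bigOr_seq; split.
  case=> n nd /sat_bigOr_seq[m md /sat_And[sn /sat_And[/sat_Against[s' [ag]]]]].
  case/sat_And=> tm /sat_And[/sat_Or lo /sat_POverrulingAll[_ ov]].
  move=> /sat_AccordingAll[ds acc].
  split=> //; exists s'; split.
    split=> //; first exact/sgraphE_out/SAgainst_edge.
      (* The disjunction of a negation with [Lower (nm n)] encodes the implication of the body. *)
      by move=> is'; case: lo => // /sat_Lower/(exists_named _ sn).
    move=> t [os' lt]; have /sat_Imp := ov t os'; apply; apply/sat_Fhat.
    split; first exact: (overrules_assessed os').1.
    by exists s.
  move=> s'' _ as''; have ds'' := SAccording_assessed as''.
  case/sat_Or: (acc s'' as'') =>
    [/sat_And[i /sat_Neg nlo]|/sat_Or[/sat_POverruling[t [ot]]|]].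
  - apply: Or31; split=> // b; apply: nlo; apply/sat_Lower.
    exact/(exists_named _ sn).
  - case/sat_And=> /sat_Fhat[_ /(exists_named _ sn) lt] ni.
    by apply: Or32; exists t.
  - by move/(sat_same_higher ds'' tm) => h; apply: Or33.
case=> ds [s' [[_ ag is' ov] acc]].
have [n nd sn] := assessed_name ds.
have [_ ds'] := SAgainst_assessed ag.
have [m md tm] := assessed_name ds'.
exists n => //; apply/sat_bigOr_seq; exists m => //; apply/sat_And; split=> //.
apply/sat_And; split.
  apply/sat_Against; exists s'; split=> //; apply/sat_And; split=> //.
  apply/sat_And; split.
    apply/sat_Or; have [i|] := pselect (sat s' phi); last by left.
    by right; apply/sat_Lower/(exists_named _ sn); exact: is'.
  apply/sat_POverrulingAll; split=> // t ot; apply/sat_Imp.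
  by move=> /sat_Fhat[_ /(exists_named _ sn) lt]; apply: ov.
apply/sat_AccordingAll; split=> // s'' as''.
have ds'' := SAccording_assessed as''.
apply/sat_Or; case: (acc s'' (sgraphE_out (SAccording_edge as'')) as'').
- case=> i nb; left; apply/sat_And.
  split=> //; apply/sat_Neg => /sat_Lower/(exists_named _ sn); exact: nb.
- case=> t [[ot lt] ni]; right; apply/sat_Or; left; apply/sat_POverruling.
  exists t; split=> //; apply/sat_And; split=> //; apply/sat_Fhat.
  by split; [exact: (overrules_assessed ot).1|exists s].
- by move=> h; right; apply/sat_Or; right; exact/(sat_same_higher ds'' tm).
Qed.

End Sat.

(** * Descendants counted by names, and exactness of the iterates *)

Section Bar.
Variables (Facts Names : countType) (Courts : finType) (Names_d : {fset Names}).
Variable C : tjcm_bar Facts Courts Names_d.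
Implicit Types (s t : states C).

(** Counting names rather than states gives a measure directly comparable with the size of
    [Names_d]. The restriction to [Names_d] loses nothing, as descendants are assessed. *)
Definition desc_names s : {fset Names} :=
  [fset n in Names_d | `[< exists2 t, desc t s & val t (Name n) >]]%fset.

Lemma desc_namesP s n :
  n \in desc_names s <-> exists2 t, desc t s & val t (Name n).
Proof.
rewrite !inE /=; split=> [/andP[_ /asboolP]|h] //.
rewrite asboolT // andbT; case: h => t d tn.
exact: assessed_Names_d (desc_assessed d) tn.
Qed.

Lemma desc_names_sub s : (desc_names s `<=` Names_d)%fset.
Proof. by apply/fsubsetP => n; rewrite !inE => /andP[]. Qed.

Lemma desc_names_self s n : val s (Name n) -> n \notin desc_names s.
Proof.
move=> sn; apply/negP => /desc_namesP[t d tn].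
by apply: (@desc_irr _ _ _ _ C s); rewrite -{1}(name_inj tn sn).
Qed.

(** The inclusion is transitivity of [desc]. It is strict because a name of [t] is counted for [s]
    but, by acyclicity, not for [t]. *)
Lemma card_desc_names_lt s t :
  desc t s -> #|` desc_names t| < #|` desc_names s|.
Proof.
move=> d; apply: fproper_ltn_card; rewrite fproperEneq andbC.
have sub : (desc_names t `<=` desc_names s)%fset.
  apply/fsubsetP => n /desc_namesP[u du un]; apply/desc_namesP; exists u => //.
  exact: t_trans du d.
have [n tn] := states_name t; have /negP := desc_names_self tn.
rewrite sub; apply: contra_notN => /eqP ->.
by apply/desc_namesP; exists t.
Qed.

Lemma card_desc_names_assessed s :
  cls s <> None -> #|` desc_names s| < #|` Names_d|.
Proof.
move=> /assessed_name[n nd sn]; apply: fproper_ltn_card.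
rewrite fproperEneq desc_names_sub andbT.
by apply: contraNneq (desc_names_self sn) => ->.
Qed.

Lemma Incuriam_against s : Incuriam s -> exists t, SAgainst s t.
Proof. by case/incuriamE=> _ [t [[_ ag _ _] _]]; exists t. Qed.

Lemma sat_inc_iter k s : #|` desc_names s| < k ->
  sat s (inc_iter _ _ Names_d k) <-> Incuriam s.
Proof.
elim: k s => [//|[_ s|k IH s]].
  rewrite ltnS leqn0 => /eqP s0.
  have leaf t : ~ SAgainst s t.
    move=> /SAgainst_edge e.
    by have := card_desc_names_lt (t_step _ _ _ _ e); rewrite s0.
  by split=> [/sat_inc_first|/Incuriam_against] [t /leaf].
(* Both sides are now instances of the same body, which consults its recursive calls only at
   descendants of [s]; there the count drops and the induction hypothesis applies. *)
rewrite ltnS => le; rewrite [inc_iter _ _ _ _]/= sat_inc_next incuriamE.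
have ih t : desc t s -> sat t (inc_iter _ _ Names_d k.+1) <-> Incuriam t.
  by move=> /card_desc_names_lt lt; apply: IH; exact: leq_trans lt le.
by split; apply: incuriam_body_ext => t /ih // ->.
Qed.

Lemma sat_FIncuriam s : sat s (FIncuriam _ _ Names_d) <-> Incuriam s.
Proof.
(* An undecided state has no name in [Names_d], so its descendants may exhaust [Names_d] and the
   counting bound is lost. Both sides are false there instead: every iterate with positive index
   requires an assessed state. *)
have [f|ds] := pselect (cls s = None).
  have nag t : ~ SAgainst s t by case=> o []; rewrite f.
  split; last by case/Incuriam_against=> t /nag.
  case/sat_bigOr_seq=> k; rewrite mem_index_iota => /andP[k1 kN].
  move=> /sat_bigAnd_seq/(_ k); rewrite mem_index_iota leqnn kN => /(_ isT).
  case: k k1 {kN} => [//|[|k]] _; first by case/sat_inc_first=> t /nag.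
  by case/sat_inc_next.
have lt := card_desc_names_assessed ds.
rewrite -(sat_inc_iter lt) sat_bigOr_seq; split.
  (* Every disjunct contains the conjunct for the last index, the size of [Names_d]; conversely the
     disjunct starting at that index has no other conjunct. *)
  case=> k; rewrite mem_index_iota => /andP[_ kN].
  by move=> /sat_bigAnd_seq; apply; rewrite mem_index_iota ltnSn andbT.
move=> h; exists #|` Names_d|.
  by rewrite mem_index_iota ltnS leqnn andbT; exact: leq_ltn_trans lt.
apply/sat_bigAnd_seq => j; rewrite mem_index_iota ltnS => jN.
by rewrite -(anti_leq jN).
Qed.

(** * Binding and best precedents *)

Lemma sat_FOverruled s : sat s (FOverruled _ _ Names_d) <-> SOverruled s.
Proof.
rewrite sat_POverruling; split=> [] [t [ov ni]]; exists t; split=> //.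
  by move/sat_FIncuriam.
by move/sat_FIncuriam.
Qed.

Lemma sat_Binding s n phi : sat s (Binding Names_d n phi) <->
  val s (Name n) /\ exists t, beta_bar s t /\ sat t phi.
Proof.
rewrite sat_bigOr_seq; split.
  case=> m md /sat_PBinding[sn [t [tm lt R B]]].
  case/sat_And=> st /sat_And[/sat_Neg nov /sat_Neg nin].
  split=> //; exists t; split=> //; split.
  - have := name_assessed tm md; case f: (cls t) => [o|//] _.
    by exists o.
  - case=> it sc; apply: nin; apply/sat_And; split; first exact/sat_FIncuriam.
    by apply/sat_SameCourt/(exists_named _ sn); rewrite /same_court sc.
  - by move=> /sat_FOverruled.
case=> sn [t [[[o b] nin nov] st]].
have [m md tm] := assessed_name (binds_assessed b).
exists m => //; apply/sat_PBinding; split=> //; case: b => [[_ R lt] B].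
exists t; split=> //; do 2![apply/sat_And; split=> //].
  by apply/sat_Neg => /sat_FOverruled.
apply/sat_Neg => /sat_And[/sat_FIncuriam it].
move=> /sat_SameCourt/(exists_named _ sn) sc.
by apply: nin; split=> //; rewrite /same_court sc.
Qed.

Lemma beta_bar_assessed s t : beta_bar s t -> cls t <> None.
Proof. by case=> [[o /binds_assessed]]. Qed.

(** With [m] naming the candidate [t], the negated conjunct is evaluated at a rival [u]:
    [Lower (nm m)] says that the court of [u] is higher than that of [t], and the other disjunct
    that [u] is a later decision of the same court. [Phat] sees only assessed states, which all
    members of [beta_bar] are. *)
Lemma sat_BestBinding s n phi : sat s (BestBinding Names_d n phi) <->
  val s (Name n) /\ exists t, BestTH (beta_bar s) t /\ sat t phi.
Proof.
rewrite sat_bigOr_seq; split.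
  case=> m md /sat_And[/sat_Binding[sn [t [bt /sat_And[tm st]]]] /sat_Neg nb].
  split=> //; exists t; split=> //; split=> // u bu; split=> h; apply: nb.
    apply/sat_Binding; split=> //; exists u; split=> //; apply/sat_Or; left.
    exact/sat_Lower/(exists_named _ tm).
  apply/sat_Binding; split=> //; exists u; split=> //; apply/sat_Or; right.
  case: h => sc lt; apply/sat_And; split.
    by apply/sat_SameCourt/(exists_named _ tm); rewrite /same_court sc.
  apply/sat_Phat; split; first exact: beta_bar_assessed bu.
  by exists t; split=> //; exact: beta_bar_assessed bt.
case=> sn [t [[bt best] st]].
have [m md tm] := assessed_name (beta_bar_assessed bt).
exists m => //; apply/sat_And; split.
  by apply/sat_Binding; split=> //; exists t.
apply/sat_Neg => /sat_Binding[_ [u [bu]]]; have [nlow nlate] := best u bu.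
case/sat_Or=> [/sat_Lower/(exists_named _ tm) //|/sat_And[]].
move=> /sat_SameCourt/(exists_named _ tm) sc.
case/sat_Phat=> _ [t' [_ lt /name_inj/(_ tm) e]]; apply: nlate.
by split; [rewrite /same_court sc|rewrite -e].
Qed.

End Bar.

(** * The classification of the undecided state *)

Theorem proposition13 (Facts Names : countType) (Courts : finType)
  (Facts_neq0 : inhabited Facts) (Names_neq0 : inhabited Names)
  (Courts_neq0 : inhabited Courts)
  (Names_d : {fset Names}) (C : tjcm_bar Facts Courts Names_d)
  (sstar : states C) (sstar_undecided : cls sstar = None)
  (n : Names) (o : bool) :
  sat sstar (Cl Facts Courts Names_d n o) <->
  sat sstar (Atom (Name n)) /\ fstar sstar sstar = [set Some o].
Proof.
rewrite /fstar asboolT //; split.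
  case/sat_And=> /sat_BestBinding[sn [t [best ft]]] /sat_Neg nbest; split=> //.
  apply/seteqP; split=> [_ [u bu <-]|_ ->]; last by exists t.
  (* Best precedents are assessed, so a value other than [o] can only be its complement, which the
     second conjunct of [Cl] rules out. *)
  have := beta_bar_assessed bu.1; case fu: (cls u) => [o'|//] _ /=.
  have [->//|ne] := eqVneq o' o; case: nbest; apply/sat_BestBinding.
  split=> //; exists u; split=> //; rewrite /= fu.
  by case: o o' ne {fu ft} => [] [].
case=> sn /seteqP[sub sup]; apply/sat_And; split.
  have [t bt ft] := sup _ erefl; apply/sat_BestBinding.
  by split=> //; exists t.
apply/sat_Neg => /sat_BestBinding[_ [t [bt ft]]].
have /sub [] : [set cls s' | s' in BestTH (beta_bar sstar)] (Some (~~ o)).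
  by exists t.
by case: o {sub sup ft}.
Qed.
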